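(* Let $G$ be a finite Cayley integral group. Then $G$ contains two non-commuting elements of order $2$ if and only if $G\cong S_3$.
   Context: For a finite group $G$ with identity $1$ and a subset $S\subseteq G\setminus\{1\}$ with $S=S^{-1}$, the undirected Cayley graph $Cay(G,S)$ has vertex set $G$, with vertices $a,b$ adjacent whenever $ab^{-1}\in S$. A graph is integral if all eigenvalues of its adjacency matrix are integers. A finite group $G$ is called Cayley integral if $Cay(G,S)$ is integral for every such subset $S$. *)

(* Defs.v *)
From HB Require Import structures.
From mathcomp Require Import all_boot all_order all_algebra all_fingroup all_field.

Set Implicit Arguments.
Unset Strict Implicit.
Unset Printing Implicit Defensive.

Import Order.TTheory GRing.Theory Num.Theory.

(* The graph with vertex set V and adjacency relation e; rows and columns are
   indexed by the enumeration of V. Entries are taken in algC, which contains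
   all the complex eigenvalues of an integer matrix. *)
Definition adjacency_mx (T : finType) (V : {set T}) (e : rel T) : 'M[algC]_#|V| :=
  (\matrix_(i < #|V|, j < #|V|) (e (enum_val i) (enum_val j))%:R)%R.

Definition integral_graph (T : finType) (V : {set T}) (e : rel T) : Prop :=
  forall x : algC, eigenvalue (adjacency_mx V e) x -> x \is a Num.int.

Definition cayley_rel (gT : finGroupType) (S : {set gT}) : rel gT :=
  fun a b => (a * b^-1)%g \in S.

Definition cayley_integral (gT : finGroupType) (G : {group gT}) : Prop :=
  forall S : {set gT},
    S \subset (G^#)%g -> (S^-1)%g = S -> integral_graph G (cayley_rel S).

(* Main.v *)
Require Import Defs.
From HB Require Import structures.
From mathcomp Require Import all_boot all_order all_algebra all_fingroup all_solvable all_field.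
From mathcomp Require Import ring zify.

Set Implicit Arguments.
Unset Strict Implicit.
Unset Printing Implicit Defensive.

Import Order.TTheory GRing.Theory Num.Theory.

Local Open Scope group_scope.

(** Integrality is used through explicit eigenfunctions on G: if T_S is the
    adjacency operator and T_S^2 f = m^2 f with f nonzero, then m or -m is an
    eigenvalue. Applied to a function on which the rotation x y acts by a
    primitive root of unity, the set {x, y} of two non-commuting involutions
    forces (x y)^3 = 1. The same method shows that only 1 centralizes both
    x and y. An involution z outside the triangle {x, y, x y x} would then not
    commute with any of its points, so all the products in sight have order 3;
    a commutator computation produces an element centralizing x and y, whose
    triviality makes x y and x z commute, and {x, y, z} gives the eigenvalue
    sqrt 3. Hence G acts faithfully by conjugation on a triangle of
    involutions, and |G| <= 6. *)

(** * Eigenfunctions and integrality *)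

(** The values of [f] along the enumeration of [G] form a left eigenvector: column [h] of the matrix
    is supported on the elements [s * h] with [s] in [S]. *)
Lemma cayley_integral_eigenfunction (gT : finGroupType) (G : {group gT})
    (S : {set gT}) (f : gT -> algC) (k : algC) :
    cayley_integral G -> S \subset G^# -> S^-1 = S ->
    (exists2 g, g \in G & f g != 0%R) ->
    {in G, forall g, \sum_(s in S) f (s * g)%g = k * f g}%R ->
  k \is a Num.int.
Proof.
move=> hG sSG SV [g0 Gg0 nzf] eigf; apply: (hG S sSG SV); apply/eigenvalueP.
exists (\row_j f (enum_val j))%R; last first.
  apply: contraNneq nzf => /rowP/(_ (enum_rank_in Gg0 g0)).
  by rewrite !mxE enum_rankK_in // => ->.
apply/rowP=> j; rewrite !mxE; set h := enum_val j.
have Gh : h \in G by apply: enum_valP.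
rewrite -eigf //.
transitivity (\sum_(g in G) f g * ((g * h^-1)%g \in S)%:R)%R.
  by rewrite [RHS]big_enum_val; apply: eq_bigr => i _; rewrite !mxE.
rewrite (bigID (fun g => g * h^-1 \in S)) /= [X in (_ + X)%R]big1; last first.
  by move=> g /andP[_ /negPf->]; rewrite mulr0.
rewrite addr0 (reindex_inj (mulIg h)) /=.
apply: eq_big => [s|s /andP[_ ->]]; last by rewrite mulr1.
rewrite mulgK groupMr //; apply: andb_idl => /(subsetP sSG).
by rewrite !inE => /andP[].
Qed.

(** With T the operator of [S], T^2 - m^2 = (T - m)(T + m): either T f + m f is an eigenfunction for
    [m], or it vanishes on [G] and [f] is one for [-m]. *)
Lemma cayley_integral_sqr_eigenfunction (gT : finGroupType) (G : {group gT})
    (S : {set gT}) (f : gT -> algC) (m : algC) :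
    cayley_integral G -> S \subset G^# -> S^-1 = S ->
    (exists2 g, g \in G & f g != 0%R) ->
    {in G, forall g,
      \sum_(s in S) \sum_(t in S) f (t * (s * g))%g = m ^+ 2 * f g}%R ->
  m \is a Num.int.
Proof.
move=> hG sSG SV nzf eigf.
pose f1 g := (\sum_(s in S) f (s * g)%g + m * f g)%R.
have eigf1 : {in G, forall g, \sum_(s in S) f1 (s * g)%g = m * f1 g}%R.
  move=> g Gg.
  by rewrite big_split /= eigf // -mulr_sumr /f1 mulrDr mulrA addrC expr2.
have [/exists_inP nzf1|/exists_inPn zf1] := boolP [exists g in G, f1 g != 0%R].
  by apply: (cayley_integral_eigenfunction (f := f1)) eigf1.
rewrite -rpredN; apply: (cayley_integral_eigenfunction (f := f) hG sSG SV nzf).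
by move=> g /zf1/negPn/eqP/addr0_eq; rewrite mulNr => <-; rewrite opprK.
Qed.

(** * Eigenspaces of left translations *)

(** When [z ^+ #[r] = 1], this is, up to the factor [#[r]], the projection of [f] onto the
    [z]-eigenspace of left translation by [r]. *)
Definition twist (gT : finGroupType) (r : gT) (z : algC) (f : gT -> algC) :
  gT -> algC := fun g => (\sum_(i < #[r]) z ^- i * f (r ^+ i * g)%g)%R.

Section Twist.

Variables (gT : finGroupType) (r : gT) (z : algC).
Hypothesis zr : (z ^+ #[r] = 1)%R.

Lemma twist_nz : (z != 0)%R.
Proof.
apply/eqP=> z0; move/eqP: zr; rewrite z0 expr0n; have:= order_gt0 r.
by case: #[r] => //= n _; rewrite eq_sym oner_eq0.
Qed.

Lemma twistE f g : (twist r z f (r * g)%g = z * twist r z f g)%R.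
Proof.
have := twist_nz => z0.
rewrite /twist mulr_sumr.
case: #[r] (order_gt0 r) zr (expg_order r) => // n _ zn rn.
(* The last term on the left wraps around to the term [i = 0] on the right. *)
rewrite big_ord_recr [RHS]big_ord_recl /= mulgA -expgSr rn addrC; congr (_ + _)%R.
  rewrite expr0 invr1 !mul1r expg0; congr (_ * _)%R.
  by apply: (mulfI (expf_neq0 n z0)); rewrite mulfV ?expf_neq0 // -exprSr.
apply: eq_bigr => i _; rewrite mulgA -expgSr mulrA; congr (_ * _)%R.
by rewrite /bump /= exprS invfM mulrA mulfV // mul1r.
Qed.

(** Lets eigenconditions for commuting elements be imposed one after the other. *)
Lemma twist_commute (f : gT -> algC) c k :
    commute c r -> (forall g, f (c * g)%g = k * f g)%R ->
  (forall g, twist r z f (c * g)%g = k * twist r z f g)%R.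
Proof.
move=> cr fc g; rewrite /twist mulr_sumr; apply: eq_bigr => i _.
by rewrite mulrCA -fc !mulgA (commuteX i cr).
Qed.

End Twist.

Lemma twist_eigenV (gT : finGroupType) r z (f : gT -> algC) :
    (z != 0)%R -> (forall g, f (r * g)%g = z * f g)%R ->
  (forall g, f (r^-1 * g)%g = z^-1 * f g)%R.
Proof. by move=> z0 fr g; rewrite -{2}(mulKVg r g) fr mulKf. Qed.

(** Serves to show that a twist is not the zero function. *)
Lemma twist_id (gT : finGroupType) (r : gT) z (f : gT -> algC) :
    (forall i : 'I_#[r], i != 0 :> nat -> f (r ^+ i) = 0%R) ->
  twist r z f 1 = f 1.
Proof.
rewrite /twist; have := order_gt0 r; case: #[r] => // n _ f0.
rewrite big_ord_recl big1 => [|i _]; first by rewrite expr0 invr1 mul1r addr0 mulg1.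
by rewrite mulg1 f0 // mulr0.
Qed.

(** * Pairs of non-commuting involutions *)

Section CayleyIntegral.

Variables (gT : finGroupType) (G : {group gT}).
Hypothesis hG : cayley_integral G.

Lemma involution_sq (x : gT) : #[x] = 2 -> x * x = 1.
Proof. by move=> x2; rewrite -[RHS](expg_order x) x2. Qed.

Lemma involution_inv (x : gT) : #[x] = 2 -> x^-1 = x.
Proof. by move=> /involution_sq xx; apply/eqP; rewrite eq_invg_mul xx. Qed.

Lemma involution_neq1 (x : gT) : #[x] = 2 -> x != 1.
Proof. by move=> x2; rewrite -order_eq1 x2. Qed.

Lemma involutionP (x : gT) : x * x = 1 -> x != 1 -> #[x] = 2.
Proof.
move=> xx x1; apply: nt_prime_order => //.
Qed.

Lemma eq1_exists_nz (x : gT) (f : gT -> algC) :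
  x \in G -> f x = 1%R -> exists2 g, g \in G & f g != 0%R.
Proof. by move=> Gx fx; exists x => //; rewrite fx oner_neq0. Qed.

(** The operator of [{x, y}] squares to 2 + r + 1/r, which acts on the twist [f] as 2 + z + 1/z.
    That number is thus the square of an integer, which restricts the order of [z], equal to that of
    [r]. *)
Lemma noncommuting_involutions_mul3 x y :
    x \in G -> y \in G -> #[x] = 2 -> #[y] = 2 -> ~ commute x y ->
  (x * y) ^+ 3 = 1.
Proof.
move=> Gx Gy x2 y2 ncxy; set r := x * y.
have yx : y * x = r^-1 by rewrite invMg !involution_inv.
have [z pz] := C_prim_root_exists (order_gt0 r).
have zr := prim_expr_order pz; have z0 := twist_nz zr.
pose f := twist r z (fun g => (g == 1%g)%:R%R).
have fr g : (f (r * g)%g = z * f g)%R by apply: twistE.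
have frV g := twist_eigenV z0 fr g.
have f1 : f 1 = 1%R.
  rewrite /f twist_id ?eqxx // => i i0.
  by rewrite -order_dvdn gtnNdvd // lt0n.
have xy : x != y by apply: contra_not_neq ncxy => ->.
have : sqrtC (2 + z + z^-1) \is a Num.int.
  apply: (@cayley_integral_sqr_eigenfunction _ G [set x; y] f) => //.
  - by apply/subsetP=> g; rewrite !inE => /orP[]/eqP->; rewrite involution_neq1.
  - by rewrite invUg !invg_set1 !involution_inv.
  - exact: eq1_exists_nz f1.
  move=> g _; rewrite sqrtCK.
  do 3!rewrite big_setU1 ?inE //= big_set1.
  rewrite !mulgA !involution_sq // yx frV fr !mul1g; ring.
case/intrP=> m /(congr1 (fun t => t ^+ 2)%R); rewrite sqrtCK => zm.
have nz : (`|z| = 1)%R.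
  by apply/eqP; rewrite -(@pexpr_eq1 _ _ #[r]) // -normrX zr normr1.
(* Since |z| = 1, the triangle inequality bounds 2 + z + 1/z by 4. *)
have m4 : (m ^+ 2 <= 4)%R.
  rewrite -(@ler_int algC) rmorphXn /= -[X in (X <= _)%R]ger0_norm; last first.
    by rewrite -rmorphXn ler0z sqr_ge0.
  rewrite -zm -[4%:~R%R]/(4%:R)%R.
  have -> : (4%:R = `|2| + `|z| + `|z^-1| :> algC)%R.
    by rewrite normfV nz invr1 normr_nat; ring.
  by rewrite !(le_trans (ler_normD _ _)) // lerD2r ler_normD.
have zm2 : (z ^+ 2 + (2 - m%:~R ^+ 2) * z + 1 = 0)%R by rewrite -zm; field.
apply/eqP; rewrite -order_dvdn (prim_order_dvd pz).
have [mge mle] : (- 2 <= m)%R /\ (m <= 2)%R by split; nia.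
(* The three values give z = -1, z^2 + z + 1 = 0 and z = 1; the first would mean r^2 = 1, so that
   [x] and [y] commute. *)
have [m0|[m1|mm]] : (m ^+ 2 = 0 \/ m ^+ 2 = 1 \/ m ^+ 2 = 4)%R.
  have : (m = -2 \/ m = -1 \/ m = 0 \/ m = 1 \/ m = 2)%R by lia.
  by case=> [|[|[|[]]]] ->; lia.
- have {}zm2 : ((z + 1) ^+ 2 = 0)%R.
    by rewrite -zm2 -rmorphXn m0 /=; ring.
  move/eqP: zm2; rewrite expf_eq0 addr_eq0 /= => /eqP z1.
  have : (z ^+ 2 == 1)%R by rewrite z1 sqrrN expr1n.
  rewrite -(prim_order_dvd pz 2) order_dvdn expgS => /eqP rr.
  case: ncxy; rewrite /commute yx -/r; apply/eqP.
  rewrite eq_sym eq_invg_mul. by apply/eqP; exact: rr.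
- have {}zm2 : (z ^+ 2 + z + 1 = 0)%R by rewrite -zm2 -rmorphXn m1 /=; ring.
  have -> : (z ^+ 3 = (z - 1) * (z ^+ 2 + z + 1) + 1)%R by ring.
  by rewrite zm2 mulr0 add0r.
have {}zm2 : ((z - 1) ^+ 2 = 0)%R by rewrite -zm2 -rmorphXn mm /=; ring.
by move/eqP: zm2; rewrite expf_eq0 subr_eq0 /= => /eqP->; rewrite expr1n.
Qed.

Lemma noncommuting_involutions_braid x y :
    x \in G -> y \in G -> #[x] = 2 -> #[y] = 2 -> ~ commute x y ->
  x * y * x = y * x * y.
Proof.
move=> Gx Gy x2 y2 /(noncommuting_involutions_mul3 Gx Gy x2 y2) xy3.
rewrite -[x * y * x](mulgK (y * x * y)).
have -> : x * y * x * (y * x * y) = 1 by rewrite -xy3 !expgS expg0 !mulg1 !mulgA.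
by rewrite mul1g !invMg !involution_inv // mulgA.
Qed.

(** [x * z] is again an involution not commuting with [y], so 1 = (xzy)^3 = z^3 (xy)^3 = z. *)
Lemma noncommuting_involutions_centP x y z :
    x \in G -> y \in G -> #[x] = 2 -> #[y] = 2 -> ~ commute x y ->
  z \in G -> z * z = 1 -> commute z x -> commute z y -> z = 1.
Proof.
move=> Gx Gy x2 y2 ncxy Gz zz zx zy.
have ncxzy : ~ commute (x * z) y.
  move=> cxzy; apply: ncxy; rewrite /commute -[x in LHS](mulgK z).
  rewrite -{2}[x](mulgK z) mulgA -cxzy -!mulgA; congr (x * (z * _)).
  by apply/esym/commuteV/commute_sym.
have xz1 : x * z != 1.
  by apply/eqP => xz1; apply: ncxzy; rewrite xz1; apply/commute_sym/commute1.
have xz2 : #[x * z] = 2.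
  apply: involutionP => //.
  by rewrite -{1}zx -mulgA [x * (x * z)]mulgA involution_sq // mul1g.
have := noncommuting_involutions_mul3 (groupM Gx Gz) Gy xz2 y2 ncxzy.
rewrite -zx -mulgA expgMn; last exact: commuteM.
rewrite (noncommuting_involutions_mul3 Gx Gy x2 y2 ncxy) mulg1.
by rewrite !expgS expg0 !mulg1 zz mulg1.
Qed.

(** Otherwise [x], [z] and [x * z] are involutions, none commuting with [y], and their three braid
    relations with [y] force [z = y]. *)
Lemma noncommuting_involution_cent x y z :
    x \in G -> y \in G -> #[x] = 2 -> #[y] = 2 -> ~ commute x y ->
  z \in G -> #[z] = 2 -> commute z x -> z = x.
Proof.
move=> Gx Gy x2 y2 ncxy Gz z2 zx; apply/eqP; apply: contraT => zNx.
have [xx yy zz] := And3 (involution_sq x2) (involution_sq y2) (involution_sq z2).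
have nczy : ~ commute z y.
  move=> zy; move: (involution_neq1 z2).
  by rewrite (noncommuting_involutions_centP Gx Gy x2 y2 ncxy Gz zz zx zy) eqxx.
have xzxz : x * z * (x * z) = 1 by rewrite -{1}zx -mulgA [x * (x * z)]mulgA involution_sq // mul1g.
have xz1 : x * z != 1.
  by rewrite -eq_invg_mul involution_inv // eq_sym.
have ncxzy : ~ commute (x * z) y.
  move=> xzy; case/negP: xz1; apply/eqP.
  apply: (noncommuting_involutions_centP Gx Gy) => //; first exact: groupM.
  exact/commute_sym/commuteM/commute_sym.
have B1 := noncommuting_involutions_braid Gx Gy x2 y2 ncxy.
have B2 := noncommuting_involutions_braid Gz Gy z2 y2 nczy.
have B3 := noncommuting_involutions_braid (groupM Gx Gz) Gy (involutionP xzxz xz1) y2 ncxzy.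
have yyK t : t * y * y = t by rewrite -mulgA yy mulg1.
have zzK t : t * z * z = t by rewrite -mulgA zz mulg1.
(* Conjugation by [y] is applied to [x] and [z] separately; [B3] then evaluates [y * (x * z) * y] a
   second way. *)
have H : y * (x * z) * y = z * y * x.
  transitivity ((y * x * y) * (y * z * y)); first by rewrite !mulgA yyK.
  rewrite -B1 -B2 (_ : _ * _ = x * (y * (x * z) * y) * z); last by rewrite !mulgA.
  by rewrite -B3 !mulgA zzK xx mul1g.
case: nczy; suff -> : z = y by [].
have : x * y * x * z = y * x.
  by apply: (mulgI z); rewrite !mulgA -H -B3 zx !mulgA.
rewrite B1 -!mulgA => /mulgI; rewrite -[RHS]mulg1 => /mulgI yz.
by rewrite -[z](mulKg y) yz mulg1 involution_inv.
Qed.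

Lemma noncommuting_involutions_order_mul x y :
    x \in G -> y \in G -> #[x] = 2 -> #[y] = 2 -> ~ commute x y ->
  #[x * y] = 3.
Proof.
move=> Gx Gy x2 y2 ncxy; apply: nt_prime_order => //.
  exact: noncommuting_involutions_mul3.
apply: contra_not_neq ncxy => xy1; rewrite /commute xy1.
by apply: (mulgI x); rewrite mulgA xy1 mulg1 mul1g.
Qed.

(** * The centralizer of two non-commuting involutions *)

Lemma prim_root3_sum (w : algC) :
  3.-primitive_root%R w -> (w ^+ 2 = - 1 - w)%R.
Proof.
move=> pw; have /eqP := prim_expr_order pw.
have w1 : (w - 1 != 0)%R by rewrite subr_eq0 -[w]expr1 -(prim_order_dvd pw).
rewrite -subr_eq0 (_ : w ^+ 3 - 1 = (w - 1) * (w ^+ 2 + w + 1))%R; last by ring.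
rewrite mulf_eq0 (negPf w1) /= => /eqP w2.
by rewrite -[LHS]subr0 -w2; ring.
Qed.

Lemma prim_root3_inv (w : algC) :
  3.-primitive_root%R w -> (w^-1 = - 1 - w)%R.
Proof.
move=> pw; have w3 := prim_expr_order pw.
have w0 : w != 0%R by apply: contra_eq_neq w3 => ->; rewrite expr0n eq_sym oner_eq0.
by rewrite -(prim_root3_sum pw); apply: (mulfI w0); rewrite mulfV // -exprS.
Qed.

(* On the tensor product of the 2-dimensional representation of <x, y> and a
   faithful character of <c>, with k = z + 1/z, the operator y + x (c + 1/c)
   squares to k^2 - k + 1, which is a square only for k = 0 and k = 1. *)
Lemma noncommuting_involutions_cent1 x y c :
    x \in G -> y \in G -> #[x] = 2 -> #[y] = 2 -> ~ commute x y ->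
  c \in G -> commute c x -> commute c y -> c = 1.
Proof.
move=> Gx Gy x2 y2 ncxy Gc cx cy.
have [xx yy] := (involution_sq x2, involution_sq y2).
apply/eqP; apply: contraT => cN1.
have inv1 t : t \in G -> t * t = 1 -> commute t x -> commute t y -> t = 1.
  exact: noncommuting_involutions_centP.
have [z pz] := C_prim_root_exists (order_gt0 c).
have zr := prim_expr_order pz; have z0 := twist_nz zr.
pose h := twist c z (fun g => (g == 1%g)%:R%R).
have hc g : (h (c * g)%g = z * h g)%R by apply: twistE.
have h1 : h 1 = 1%R.
  rewrite /h twist_id ?eqxx // => i i0.
  by rewrite -order_dvdn gtnNdvd // lt0n.
have ccV : c != c^-1.
  by apply: contraNneq cN1 => ccV; rewrite [c]inv1 // {1}ccV mulVg.
(* Integrality for [{c, c^-1}], a set of two elements by [ccV]. *)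
have /intrP[k kE] : (z + z^-1)%R \is a Num.int.
  apply: (@cayley_integral_eigenfunction _ G [set c; c^-1] h) => //.
  - apply/subsetP=> g; rewrite !inE.
    by case/orP=> /eqP->; rewrite ?invg_eq1 cN1 ?groupV.
  - by rewrite invUg !invg_set1 invgK setUC.
  - exact: eq1_exists_nz h1.
  move=> g _; rewrite big_setU1 ?inE //= big_set1 hc (twist_eigenV z0 hc).
  by rewrite mulrDl.
have [w pw] := C_prim_root_exists (isT : 0 < 3).
have r3 := noncommuting_involutions_order_mul Gx Gy x2 y2 ncxy.
set r := x * y in r3.
have wr : (w ^+ #[r] = 1)%R by rewrite r3 (prim_expr_order pw).
have w0 := twist_nz wr.
have yx : y * x = r^-1 by rewrite invMg !involution_inv.
have cr : commute c r by apply: commuteM.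
pose f := twist r w h.
have fr g : (f (r * g)%g = w * f g)%R by apply: twistE.
have frV g := twist_eigenV w0 fr g.
have fc g : (f (c * g)%g = z * f g)%R by apply: twist_commute => //.
have fcV g := twist_eigenV z0 fc g.
have rNcx : ~ commute r x.
  move=> rx; apply: ncxy; have xyx : r * x = y by rewrite rx mulgA xx mul1g.
  by rewrite /commute -{2}xyx -mulgA xx mulg1.
(* A nontrivial power of [r] inside [<[c]>] would commute with [x]; as [r] has order 3, so would
   [r]. *)
have f1 : f 1 = 1%R.
  rewrite /f twist_id // => i i0; rewrite /h /twist big1 // => j _.
  case: eqP => [cr1|_]; last by rewrite mulr0.
  have rix : commute (r ^+ i) x.
    have -> : r ^+ i = (c ^+ j)^-1 by apply/eqP; rewrite eq_sym eq_invg_mul cr1.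
    exact/commute_sym/commuteV/commuteX/commute_sym.
  case: rNcx; move: i0 (ltn_ord i) rix; rewrite [X in (_ < X)%N]r3.
  case: (i : nat) => [|[|[|]]] // _ _ rrx; rewrite ?expg1 // in rrx.
  have -> : r = (r ^+ 2)^-1.
    by apply/eqP; rewrite eq_sym eq_invg_mul -expgSr -r3 expg_order.
  exact/commute_sym/commuteV/commute_sym.
pose S := (x * c) |: [set x * c^-1; y].
have cVx : commute c^-1 x by exact/commute_sym/commuteV/commute_sym.
have cVy : commute c^-1 y by exact/commute_sym/commuteV/commute_sym.
have nyx t : commute t x -> x * t != y.
  move=> tx; apply: contra_not_neq ncxy => <-.
  by rewrite /commute mulgA xx mul1g -mulgA tx mulgA xx mul1g.
have nyx1 t : commute t x -> commute t y -> x * t != 1.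
  move=> tx ty; apply: contra_not_neq ncxy => /(congr1 (mulg x)).
  by rewrite mulgA xx mul1g mulg1 => <-.
have : sqrtC (k%:~R ^+ 2 - k%:~R + 1 : algC)%R \is a Num.int.
  apply: (@cayley_integral_sqr_eigenfunction _ G S f) => //.
  - apply/subsetP=> g; rewrite !inE => /or3P[]/eqP->.
    + by rewrite nyx1 ?groupM.
    + by rewrite nyx1 ?groupM ?groupV.
    by rewrite involution_neq1.
  - rewrite /S !invUg !invg_set1 !invMg (involution_inv x2) (involution_inv y2) invgK cVx cx.
    by rewrite setUA [_ :|: [set x * c]]setUC -setUA.
  - exact: eq1_exists_nz f1.
  have n1 : x * c \notin [set x * c^-1; y].
    by rewrite !inE (inj_eq (mulgI x)) (negPf ccV) (negPf (nyx c cx)).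
  have n2 : x * c^-1 \notin [set y] by rewrite inE nyx.
  move=> g _; rewrite sqrtCK.
  do 4!rewrite ?(big_setU1 _ n1) ?(big_setU1 _ n2) ?big_set1 /=.
  have xtxu t u : commute t x -> x * t * (x * u * g) = t * (u * g).
    by move=> tx; rewrite -tx -[LHS]mulgA -(mulgA x u) (mulgA x x) xx mul1g.
  have yxt t : y * (x * t * g) = r^-1 * (t * g) by rewrite !mulgA yx.
  have xty t : commute t x -> x * t * (y * g) = t * (r * g).
    by move=> tx; rewrite -tx !mulgA.
  rewrite !xtxu // !yxt !xty // (mulgA y) yy mul1g.
  (* The cross terms contribute k (w + 1/w) = -k. *)
  rewrite !(fc, fcV, fr, frV) (prim_root3_inv pw) -kE; field.
  by [].
case/intrP=> m /(congr1 (fun t => t ^+ 2)%R); rewrite sqrtCK => /eqP.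
rewrite -[X in (_ - _ + X)%R](rmorph1 (intmul 1)) -!rmorphXn -rmorphB -rmorphD /=.
rewrite eqr_int => /eqP km.
have zk : (z ^+ 2 = k%:~R * z - 1)%R by rewrite -kE; field.
have inv_pow n : c ^+ n * c ^+ n = 1 -> c ^+ n != 1 -> False.
  move=> cnn /eqP; apply; apply: inv1 => //; first exact: groupX.
    exact/commute_sym/commuteX/commute_sym.
  exact/commute_sym/commuteX/commute_sym.
have [k0|k1] : (k = 0 \/ k = 1)%R.
  (* For k >= 2, k^2 - k + 1 lies strictly between (k - 1)^2 and k^2; for k <= -1, strictly between
     k^2 and (1 - k)^2. *)
  have m0 : (0 <= `|m|)%R by lia.
  have {}km : (`|m| ^+ 2 = k ^+ 2 - k + 1)%R by nia.
  have [k2|[kN|]] : (2 <= k \/ k <= -1 \/ (k = 0 \/ k = 1))%R by lia.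
  - have [mk|mk] : (`|m| <= k - 1 \/ k <= `|m|)%R by lia.
      nia.
    nia.
  - have [mk|mk] : (`|m| <= - k \/ 1 - k <= `|m|)%R by lia.
      nia.
    nia.
  by [].
(* k = 0 gives z^2 = -1 and k = 1 gives z^3 = -1, so [c ^+ 2] or [c ^+ 3] would be an involution
   centralizing [x] and [y]. *)
- have z2 : (z ^+ 2 = -1)%R by rewrite zk k0; ring.
  case: (inv_pow 2).
    apply/eqP; rewrite -expgD -order_dvdn (prim_order_dvd pz).
    by rewrite (exprM z 2 2) z2 sqrrN expr1n.
  by rewrite -order_dvdn (prim_order_dvd pz) z2 eq_sym -subr_eq0 opprK (pnatr_eq0 _ 2).
have z3 : (z ^+ 3 = -1)%R by rewrite exprS zk mulrBr mulrCA -expr2 zk k1; ring.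
case: (inv_pow 3).
  apply/eqP; rewrite -expgD -order_dvdn (prim_order_dvd pz).
  by rewrite (exprM z 3 2) z3 sqrrN expr1n.
by rewrite -order_dvdn (prim_order_dvd pz) z3 eq_sym -subr_eq0 opprK (pnatr_eq0 _ 2).
Qed.

(* On functions on which r acts by 1 and s by a primitive cube root of unity, the
   operator x (1 + r + s) squares to 3. *)
Lemma noncommute_of_inverted_order3 x r s :
    x \in G -> r \in G -> s \in G -> #[x] = 2 ->
    (x * r) * (x * r) = 1 -> (x * s) * (x * s) = 1 ->
    #[r] = 3 -> #[s] = 3 -> s \notin <[r]> ->
  ~ commute r s.
Proof.
move=> Gx Gr Gs x2 xr2 xs2 r3 s3 sr rs.
have xx := involution_sq x2.
have [w pw] := C_prim_root_exists (isT : 0 < 3).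
have wr : (w ^+ #[s] = 1)%R by rewrite s3 (prim_expr_order pw).
have w0 := twist_nz wr.
pose h := twist r 1%R (fun g => (g == 1%g)%:R%R).
have hr g : (h (r * g)%g = 1 * h g)%R by apply: twistE; rewrite expr1n.
pose f := twist s w h.
have fs g : (f (s * g)%g = w * f g)%R by apply: twistE.
have fr g : (f (r * g)%g = f g)%R.
  by rewrite -[RHS]mul1r; apply: twist_commute.
have fsV g := twist_eigenV w0 fs g.
have frV g : (f (r^-1 * g)%g = f g)%R by rewrite -{2}(mulKVg r g) fr.
have r1 : r != 1 by rewrite -order_eq1 r3.
have s1 : s != 1 by rewrite -order_eq1 s3.
have rNs : r != s by apply: contraNneq sr => <-; apply: cycle_id.
(* [h] is the indicator function of [<[r]>], which contains no nontrivial power of [s]. *)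
have f1 : f 1 = 1%R.
  rewrite /f twist_id => [|i i0]; rewrite /h.
    rewrite twist_id ?eqxx // => i i0.
    by rewrite -order_dvdn gtnNdvd // lt0n.
  rewrite /twist big1 // => j _; case: eqP => [rs1|_]; last by rewrite mulr0.
  have si : s ^+ i \in <[r]>.
    have -> : s ^+ i = (r ^+ j)^-1 by apply/esym/eqP; rewrite eq_invg_mul rs1.
    by rewrite groupV mem_cycle.
  case/negP: sr; move: i0 (ltn_ord i) si; rewrite [X in (_ < X)%N]s3.
  case: (i : nat) => [|[|[|]]] // _ _; rewrite ?expg1 //.
  have <- : s^-1 = s ^+ 2 by apply/eqP; rewrite eq_invg_mul -expgS -s3 expg_order.
  by rewrite groupV.
have xinv : x^-1 = x by rewrite involution_inv.
have rinv : (x * r)^-1 = x * r by apply/eqP; rewrite eq_invg_mul xr2.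
have sinv : (x * s)^-1 = x * s by apply/eqP; rewrite eq_invg_mul xs2.
have rx : r * x = x * r^-1.
  by apply: (mulgI x); rewrite [RHS]mulgA xx mul1g; apply: (mulIg r); rewrite mulVg -xr2 !mulgA.
have sx : s * x = x * s^-1.
  by apply: (mulgI x); rewrite [RHS]mulgA xx mul1g; apply: (mulIg s); rewrite mulVg -xs2 !mulgA.
have nx1 t : t ^+ 2 != 1 -> x * t != 1.
  apply: contraNneq => xt1.
  have -> : t = x by rewrite -[t](mulKg x) xt1 mulg1.
  by rewrite expgS expg1 xx.
have r21 : r ^+ 2 != 1 by rewrite -order_dvdn r3.
have s21 : s ^+ 2 != 1 by rewrite -order_dvdn s3.
pose S := x |: [set x * r; x * s].
have : (sqrtC 3 : algC)%R \is a Num.int.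
  apply: (@cayley_integral_sqr_eigenfunction _ G S f) => //.
  - apply/subsetP=> g; rewrite !inE => /or3P[]/eqP->.
    + by rewrite involution_neq1.
    + by rewrite nx1 ?groupM.
    by rewrite nx1 ?groupM.
  - by rewrite /S !invUg !invg_set1 xinv rinv sinv.
  - exact: eq1_exists_nz f1.
  have n1 : x \notin [set x * r; x * s].
    by rewrite !inE -{1 3}[x]mulg1 !(inj_eq (mulgI x)) ![1 == _]eq_sym (negPf r1) (negPf s1).
  have n2 : x * r \notin [set x * s] by rewrite inE (inj_eq (mulgI x)).
  move=> g _; rewrite sqrtCK.
  do 4!rewrite ?(big_setU1 _ n1) ?(big_setU1 _ n2) ?big_set1 /=.
  have E1 t : x * (x * t) = t by rewrite mulgA xx mul1g.
  have E2 t : r * (x * t) = x * (r^-1 * t) by rewrite mulgA rx mulgA.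
  have E3 t : s * (x * t) = x * (s^-1 * t) by rewrite mulgA sx mulgA.
  rewrite -!mulgA !(E1, E2, E3) !(fs, fsV, fr, frV) (prim_root3_inv pw).
  (* Since [x] inverts [r] and [s], the square acts as (2 + 1/w)(2 + w) = 3. *)
  ring: (prim_root3_sum pw).
case/intrP=> m /(congr1 (fun t => t ^+ 2)%R); rewrite sqrtCK => /eqP.
rewrite -rmorphXn -[(3%:R)%R]/(3%:~R)%R eqr_int => /eqP.
have [|[|]] : (m <= -2 \/ 2 <= m \/ m \in [:: -1; 0; 1])%R by rewrite !inE; lia.
- nia.
- nia.
by rewrite !inE => /or3P[]/eqP->.
Qed.

(** * The triangle of involutions and the bound on the order *)

Lemma involution_mem_noncommuting_triangle x y z :
    x \in G -> y \in G -> #[x] = 2 -> #[y] = 2 -> ~ commute x y ->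
  z \in G -> #[z] = 2 -> z \in [set x; y; x * y * x].
Proof.
move=> Gx Gy x2 y2 ncxy Gz z2; apply: contraT.
rewrite !inE !negb_or => /andP[/andP[zx zy] zu].
have [xx yy zz] := And3 (involution_sq x2) (involution_sq y2) (involution_sq z2).
have B := noncommuting_involutions_braid Gx Gy x2 y2 ncxy.
have nczx : ~ commute x z.
  move=> czx; case/eqP: zx.
  by apply: (noncommuting_involution_cent Gx Gy).
have nczy : ~ commute y z.
  move=> czy; case/eqP: zy.
  by apply: (noncommuting_involution_cent Gy Gx) => // /commute_sym.
set u := x * y * x in zu.
have u2 : #[u] = 2 by rewrite /u -{1}[x]involution_inv // -mulgA -conjgE orderJ.
have Gu : u \in G by rewrite !groupM.
have ncux : ~ commute u x.
  rewrite /commute /u -!mulgA xx mulg1 => /mulgI yx; case: ncxy.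
  by apply: (mulgI x); rewrite mulgA xx mul1g.
have nczu : ~ commute u z.
  move=> czu; case/eqP: zu.
  by apply: (noncommuting_involution_cent Gu Gx).
have t3 : (u * z) ^+ 3 = 1 by apply: noncommuting_involutions_mul3.
have [xK yK zK] : [/\ forall v, x * (x * v) = v, forall v, y * (y * v) = v
    & forall v, z * (z * v) = v].
  by split=> v; rewrite mulgA ?xx ?yy ?zz mul1g.
have Bx := noncommuting_involutions_braid Gx Gz x2 z2 nczx.
have By := noncommuting_involutions_braid Gy Gz y2 z2 nczy.
set t := u * z in t3; set t' := x * t * x; set t'' := y * t * y.
have t'E : t' = y * (x * (z * x)) by rewrite /t' /t /u -!mulgA xK.
have t''E : t'' = x * (y * (z * y)) by rewrite /t'' /t /u B -!mulgA yK.
(* The braid relations of [z] with [y] and with [x] make the conjugates of [t] by [x] and [y]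
   commute, with product [t]. *)
have tt'' : t' * t'' = t.
  rewrite t'E t''E /t /u B -!mulgA xK; do 2!congr (_ * _).
  by apply: (mulIg y); rewrite -!mulgA yy mulg1; move: By; rewrite -!mulgA => ->.
have t''t' : t'' * t' = t.
  rewrite t'E t''E /t /u -!mulgA yK; do 2!congr (_ * _).
  by apply: (mulIg x); rewrite -!mulgA xx mulg1; move: Bx; rewrite -!mulgA => ->.
pose c := t' * t''^-1.
have t''3 : t'' ^+ 3 = 1.
  by rewrite /t'' -{1}[y]involution_inv // -mulgA -conjgE -conjXg t3 conj1g.
have t'3 : t' ^+ 3 = 1.
  by rewrite /t' -{1}[x]involution_inv // -mulgA -conjgE -conjXg t3 conj1g.
have t''V : t''^-1 = t'' * t''.
  by apply/eqP; rewrite eq_invg_mul -t''3 !expgS expg0 mulg1.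
have t'V : t'^-1 = t' * t'.
  by apply/eqP; rewrite eq_invg_mul -t'3 !expgS expg0 mulg1.
have Et'' : t'' = t * t'^-1 by rewrite -t''t' mulgK.
have xt : t ^ x = t' by rewrite conjgE involution_inv // mulgA.
have yt : t ^ y = t'' by rewrite conjgE involution_inv // mulgA.
have tE : t = (x * y) * (x * z) by rewrite mulgA.
have [Gt' Gt''] : t' \in G /\ t'' \in G by rewrite !groupM.
clearbody t' t'' t.
have xt' : t' ^ x = t by rewrite -xt -conjgM xx conjg1.
have yt'' : t'' ^ y = t by rewrite -yt -conjgM yy conjg1.
have cE : c = t * t'' by rewrite -tt'' /c t''V mulgA.
have xt'' : t'' ^ x = t' * t^-1 by rewrite {1}Et'' conjMg conjVg xt xt'.
(* [x] swaps [t] and [t'], while [y] swaps [t] and [t'']; this makes both fix [c]. *)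
have cx : c ^ x = c.
  by rewrite /c conjMg conjVg xt' xt'' invMg invgK -Et'' -cE.
have cy : c ^ y = c.
  by rewrite cE conjMg yt yt'' -{1}tt'' mulgA t''t'.
have c1 : c = 1.
  apply: (noncommuting_involutions_cent1 Gx Gy x2 y2 ncxy).
  - by rewrite groupM ?groupV ?groupM.
  - by apply/commgP/conjg_fixP.
  - by apply/commgP/conjg_fixP.
have eqt : t' = t'' by rewrite -[t'](mulgKV t'') -/c c1 mul1g.
(* Now t = t'^2 with t'^3 = 1, so [x] and [y] both invert [t] and their product centralizes it. *)
have rt : commute (x * y) t.
  have tV : t^-1 = t' by rewrite -tt'' -eqt -t'V invgK.
  apply/commute_sym/commgP/conjg_fixP.
  by rewrite conjgM xt -tV conjVg yt -eqt -tV invgK.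
have rs : commute (x * y) (x * z).
  by apply: (mulgI (x * y)); rewrite [RHS]mulgA -tE.
case: (@noncommute_of_inverted_order3 x (x * y) (x * z)) => //.
- exact: groupM.
- exact: groupM.
- by rewrite !xK.
- by rewrite !xK.
- exact: noncommuting_involutions_order_mul.
- exact: noncommuting_involutions_order_mul.
have r3 := noncommuting_involutions_order_mul Gx Gy x2 y2 ncxy.
(* If [x * z] were 1, [x * y] or its square, [z] would be [x], [y] or [u]. *)
apply/cycleP=> -[i]; rewrite -expg_mod_order r3.
case: (i %% 3)%N (ltn_pmod i (isT : 0 < 3)) => [|[|[|]]] //= _.
- rewrite expg0 => /(congr1 (mulg x)); rewrite xK mulg1 => /eqP.
  by rewrite (negPf zx).
- by rewrite expg1 => /mulgI /eqP; rewrite (negPf zy).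
rewrite expgS expg1 -!mulgA => /mulgI /eqP; rewrite (_ : y * _ = u) ?(negPf zu) //.
by rewrite /u B !mulgA.
Qed.

(** An element is determined by its conjugates of [x] and [y], an ordered pair of distinct points of
    [D]; three points give 9 - 3 pairs. *)
Lemma card_noncommuting_involutions x y :
    x \in G -> y \in G -> #[x] = 2 -> #[y] = 2 -> ~ commute x y ->
  #|G| <= 6.
Proof.
move=> Gx Gy x2 y2 ncxy; pose D := [set x; y; x * y * x].
have D3 : #|D| <= 3.
  rewrite /D -setUA cardsU1 cards2; by case: (x \notin _); case: (y != _).
have GD g : g \in G -> (x ^ g \in D) && (y ^ g \in D).
  move=> Gg; rewrite /D !involution_mem_noncommuting_triangle ?orderJ ?groupJ //.
pose F g := (x ^ g, y ^ g).
have injF : {in G &, injective F}.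
  move=> g h Gg Gh [/(congr1 (conjg^~ h^-1)) xgh /(congr1 (conjg^~ h^-1)) ygh].
  apply/(mulIg h^-1); rewrite mulgV.
  apply: (noncommuting_involutions_cent1 Gx Gy x2 y2 ncxy).
  - by rewrite groupM ?groupV.
  - by apply/commute_sym/commgP/conjg_fixP; rewrite conjgM xgh -conjgM mulgV conjg1.
  - by apply/commute_sym/commgP/conjg_fixP; rewrite conjgM ygh -conjgM mulgV conjg1.
rewrite -(card_in_imset injF).
pose diag := [set (d, d) | d in D].
have cdiag : #|diag| = #|D| by apply: card_imset => d e [].
have sdiag : diag \subset setX D D.
  by apply/subsetP=> _ /imsetP[d Dd ->]; rewrite in_setX /= Dd.
have sF : F @: G \subset setX D D :\: diag.
  apply/subsetP=> _ /imsetP[g Gg ->]; rewrite in_setD in_setX GD // andbT.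
  apply: contra_notN ncxy => /imsetP[d _ [xg yg]].
  by rewrite (conjg_inj g (etrans xg (esym yg))).
apply: leq_trans (subset_leq_card sF) _.
rewrite cardsDS // cdiag cardsX.
by case: #|D| D3 => [|[|[|[|]]]].
Qed.

End CayleyIntegral.

(** * Identification with the symmetric group *)

(** The involutions generate a dihedral subgroup of order divisible by 6, which fills [K]. Applied
    to both [G] and ['S_3], this makes ['D_6] the link between them. *)
Lemma isog_dihedral6 (gT : finGroupType) (K : {group gT}) (x y : gT) :
    #|K| <= 6 -> x \in K -> y \in K -> #[x] = 2 -> #[y] = 2 -> #[x * y] = 3 ->
  K \isog 'D_6.
Proof.
move=> leK6 Kx Ky x2 y2 xy3.
have xy : x != y.
  by apply: contra_eq_neq xy3 => <-; rewrite involution_sq // order1.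
have sHK : <<[set x; y]>> \subset K.
  by rewrite gen_subG; apply/subsetP=> g; rewrite !inE => /orP[]/eqP->.
have dv6 : (2 * 3 %| #|<<[set x; y]>>|)%N.
  rewrite Gauss_dvd // -{1}x2 -xy3 !order_dvdG ?groupM ?mem_gen ?set21 ?set22 //.
have H6 : #|<<[set x; y]>>| = 6.
  apply/eqP; rewrite eqn_leq (leq_trans (subset_leq_card sHK)) //=.
  by rewrite dvdn_leq.
have <- : <<[set x; y]>> = K by apply/eqP; rewrite eqEcard sHK H6.
by have := involutions_gen_dihedral x2 y2 xy; rewrite /= H6.
Qed.


Lemma order_tperm (T : finType) (x y : T) : x != y -> #[tperm x y] = 2.
Proof.
move=> xy; apply: nt_prime_order => //; first by rewrite expgS expg1 tperm2.
by apply: contra_neq xy => /permP/(_ x); rewrite tpermL perm1.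
Qed.

Lemma S3_isog_dihedral6 : [set: 'S_3] \isog 'D_6.
Proof.
pose a : 'S_3 := tperm 0%R 1%R; pose b : 'S_3 := tperm 0%R 2%R.
apply: (@isog_dihedral6 _ _ a b); rewrite ?inE ?order_tperm //.
  by rewrite cardsT card_Sn.
apply: nt_prime_order => //.
  apply/permP=> i; rewrite !expgS expg0 !permM perm1 /a /b !permE /=.
  by case: i => [[|[|[|]]] //= i3]; apply/val_inj.
by apply/eqP=> /permP/(_ 0%R); rewrite permM perm1 !permE.
Qed.

Theorem theorem2p12 (gT : finGroupType) (G : {group gT}) (hG : cayley_integral G) :
  (exists x y : gT,
     [/\ x \in G, y \in G, #[x] = 2, #[y] = 2 & x * y <> y * x])
  <-> G \isog [set: 'S_3].
Proof.
split=> [[x [y [Gx Gy x2 y2 ncxy]]]|].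
  apply: isog_trans (isog_symr S3_isog_dihedral6).
  apply: (isog_dihedral6 _ Gx Gy x2 y2).
    exact: card_noncommuting_involutions ncxy.
  exact: (noncommuting_involutions_order_mul hG).
rewrite isog_sym => /isogP[f injf <-].
pose a : 'S_3 := tperm 0%R 1%R; pose b : 'S_3 := tperm 0%R 2%R.
exists (f a), (f b); split; rewrite ?mem_morphim ?inE ?order_injm ?inE ?order_tperm //.
rewrite -!morphM ?inE // => /(injmP injf); rewrite !inE => /(_ isT isT).
(* The two products of transpositions send 0 to 1 and to 2. *)
by move/permP/(_ 0%R); rewrite !permM !permE.
Qed.
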